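(* For every positive integer $k$, the following identity of formal power series in $x$ holds: $$\frac{\sum_{j=0}^{k-1}\left\langle \begin{matrix} k-1\\ j\end{matrix}\right\rangle_2 x^j}{(1-x)^{2k+1}}=\sum_{n\ge0}\left\langle \begin{matrix} n+k\\ k\end{matrix}\right\rangle_2 x^n .$$
   Context: For integers $m\ge0$, $\langle m\rangle_2=\binom{m+1}{2}$, and for $0\le k\le n$, $\left\langle \begin{matrix} n\\ k\end{matrix}\right\rangle_2=\prod_{j=0}^{k-1}\frac{\langle n-j\rangle_2}{\langle k-j\rangle_2}$ (equal to $\frac{1}{k+1}\binom{n}{k}\binom{n+1}{k}$, the Narayana numbers). *)

(* Defs.v *)
From HB Require Import structures.
From mathcomp Require Import all_boot all_order all_algebra.
From mathcomp Require Import boolp.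

Set Implicit Arguments.
Unset Strict Implicit.
Unset Printing Implicit Defensive.

Import GRing.Theory.
Local Open Scope ring_scope.

(* The ring R[[x]] of formal power series.  A series is wrapped in a record,
   and not just a function nat -> R, so that its product is the Cauchy product
   and not the pointwise one. *)
Record fps (R : Type) := FPS { fps_coef : nat -> R }.

HB.instance Definition _ (R : Type) := gen_eqMixin (fps R).
HB.instance Definition _ (R : Type) := gen_choiceMixin (fps R).

Lemma fpsP (R : Type) (f g : fps R) :
  (forall n, fps_coef f n = fps_coef g n) -> f = g.
Proof. by case: f g => [f] [g] /= fg; congr FPS; apply/funext. Qed.

Section FpsZmodule.
Variable R : zmodType.
Implicit Types f g h : fps R.

Definition fps_zero : fps R := FPS (fun=> 0).
Definition fps_opp f : fps R := FPS (fun n => - fps_coef f n).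
Definition fps_add f g : fps R := FPS (fun n => fps_coef f n + fps_coef g n).

Fact fps_addA : associative fps_add.
Proof. by move=> f g h; apply: fpsP => n /=; rewrite addrA. Qed.

Fact fps_addC : commutative fps_add.
Proof. by move=> f g; apply: fpsP => n /=; rewrite addrC. Qed.

Fact fps_add0 : left_id fps_zero fps_add.
Proof. by move=> f; apply: fpsP => n /=; rewrite add0r. Qed.

Fact fps_addN : left_inverse fps_zero fps_opp fps_add.
Proof. by move=> f; apply: fpsP => n /=; rewrite addNr. Qed.

End FpsZmodule.

HB.instance Definition _ (R : zmodType) :=
  GRing.isZmodule.Build (fps R)
    (@fps_addA R) (@fps_addC R) (@fps_add0 R) (@fps_addN R).

Section FpsRing.
Variable R : comNzRingType.
Implicit Types f g h : fps R.

Definition fps_one : fps R := FPS (fun n => (n == 0%N)%:R).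

Definition fps_mul f g : fps R :=
  FPS (fun n => \sum_(i < n.+1) fps_coef f i * fps_coef g (n - i)).

Definition fps_scale (a : R) f : fps R := FPS (fun n => a * fps_coef f n).

Definition fps_trunc (m : nat) f : {poly R} := \poly_(i < m) fps_coef f i.

Fact coef_fps_trunc_mul m n (f g : fps R) : (n < m)%N ->
  fps_coef (fps_mul f g) n = (fps_trunc m f * fps_trunc m g)`_n.
Proof.
move=> ltnm; rewrite coefM /=; apply: eq_bigr => i _.
have lei : (i <= n)%N by rewrite -ltnS.
by rewrite !coef_poly (leq_ltn_trans lei ltnm) (leq_ltn_trans (leq_subr i n) ltnm).
Qed.

Fact fps_mulC : commutative fps_mul.
Proof.
by move=> f g; apply: fpsP => n; rewrite !(coef_fps_trunc_mul _ _ (ltnSn n)) mulrC.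
Qed.

Fact fps_mulA : associative fps_mul.
Proof.
move=> f g h; apply: fpsP => n.
have truncM u v i : (i < n.+1)%N ->
    (fps_trunc n.+1 (fps_mul u v))`_i = (fps_trunc n.+1 u * fps_trunc n.+1 v)`_i.
  by move=> ltin; rewrite coef_poly ltin (coef_fps_trunc_mul _ _ ltin).
rewrite !(coef_fps_trunc_mul _ _ (ltnSn n)).
transitivity (fps_trunc n.+1 f * (fps_trunc n.+1 g * fps_trunc n.+1 h))`_n.
  rewrite !(coefM (fps_trunc n.+1 f)); apply: eq_bigr => i _.
  by rewrite truncM // ltnS leq_subr.
by rewrite mulrA !(coefM _ (fps_trunc n.+1 h)); apply: eq_bigr => i _; rewrite truncM.
Qed.

Fact fps_mul1 : left_id fps_one fps_mul.
Proof.
move=> f; apply: fpsP => n /=.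
by rewrite big_ord_recl /= mul1r subn0 big1 ?addr0 // => i _; rewrite mul0r.
Qed.

Fact fps_mulDl : left_distributive fps_mul (@GRing.add (fps R)).
Proof.
move=> f g h; apply: fpsP => n /=; rewrite -big_split /=.
by apply: eq_bigr => i _; rewrite mulrDl.
Qed.

Fact fps_one_neq0 : fps_one != 0.
Proof.
apply/eqP => /(congr1 (fun f => fps_coef f 0%N)) /= /eqP.
by rewrite oner_eq0.
Qed.

End FpsRing.

HB.instance Definition _ (R : comNzRingType) :=
  GRing.Zmodule_isComNzRing.Build (fps R)
    (@fps_mulA R) (@fps_mulC R) (@fps_mul1 R) (@fps_mulDl R) (@fps_one_neq0 R).

Section FpsAlgebra.
Variable R : comNzRingType.
Implicit Types (a b : R) (f g : fps R).

Fact fps_scaleA a b f : fps_scale a (fps_scale b f) = fps_scale (a * b) f.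
Proof. by apply: fpsP => n /=; rewrite mulrA. Qed.

Fact fps_scale1 : left_id 1 (@fps_scale R).
Proof. by move=> f; apply: fpsP => n /=; rewrite mul1r. Qed.

Fact fps_scaleDr : right_distributive (@fps_scale R) +%R.
Proof. by move=> a f g; apply: fpsP => n /=; rewrite mulrDr. Qed.

Fact fps_scaleDl f : {morph (@fps_scale R)^~ f : a b / a + b}.
Proof. by move=> a b; apply: fpsP => n /=; rewrite mulrDl. Qed.

HB.instance Definition _ := GRing.Zmodule_isLmodule.Build R (fps R)
  fps_scaleA fps_scale1 fps_scaleDr fps_scaleDl.

Fact fps_scaleAl a f g : a *: (f * g) = (a *: f) * g.
Proof.
apply: fpsP => n /=; rewrite mulr_sumr.
by apply: eq_bigr => i _; rewrite mulrA.
Qed.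

HB.instance Definition _ := GRing.Lmodule_isLalgebra.Build R (fps R) fps_scaleAl.
HB.instance Definition _ := GRing.Lalgebra_isComAlgebra.Build R (fps R).

End FpsAlgebra.

Section FpsUnitRing.
Variable R : comUnitRingType.
Implicit Types f g : fps R.

(* The first m coefficients of 1 / f, computed from
   f_0 g_n = [n = 0] - \sum_(i < n) g_i f_(n - i). *)
Fixpoint fps_inv_seq f (m : nat) : seq R :=
  if m is n.+1 then
    let s := fps_inv_seq f n in
    rcons s ((fps_coef f 0)^-1 *
             ((n == 0%N)%:R - \sum_(i < n) s`_i * fps_coef f (n - i)))
  else [::].

Definition fps_unit : {pred fps R} := fun f => fps_coef f 0 \is a GRing.unit.

(* As for every unitRingType, inversion is the identity outside the units. *)
Definition fps_inv f : fps R :=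
  if f \in fps_unit then FPS (fun n => (fps_inv_seq f n.+1)`_n) else f.

Fact size_fps_inv_seq f m : size (fps_inv_seq f m) = m.
Proof. by elim: m => //= m IHm; rewrite size_rcons IHm. Qed.

Fact nth_fps_inv_seq f m n : (n < m)%N ->
  (fps_inv_seq f m)`_n = (fps_inv_seq f n.+1)`_n.
Proof.
elim: m => // m IHm; rewrite ltnS leq_eqVlt => /predU1P[-> // | ltnm].
by rewrite [LHS]nth_rcons size_fps_inv_seq ltnm IHm.
Qed.

Fact fps_mulVf : {in fps_unit, left_inverse 1 fps_inv *%R}.
Proof.
move=> f Uf; apply: fpsP => n; rewrite /fps_inv Uf /= big_ord_recr /= subnn.
rewrite nth_rcons size_fps_inv_seq ltnn eqxx -mulrC mulrA divrr // mul1r.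
rewrite addrC -[RHS](subrK (\sum_(i < n) (fps_inv_seq f n)`_i * fps_coef f (n - i))).
congr (_ + _); apply: eq_bigr => i _; congr (_ * _).
by rewrite [RHS]nth_fps_inv_seq.
Qed.

Fact fps_unitPl f g : g * f = 1 -> fps_unit f.
Proof.
move=> /(congr1 (fun h => fps_coef h 0%N)) /=.
by rewrite big_ord1 subn0 => gf1; apply/unitrPr; exists (fps_coef g 0); rewrite mulrC.
Qed.

Fact fps_inv_out : {in [predC fps_unit], fps_inv =1 id}.
Proof. by move=> f; rewrite inE /= /fps_inv => /negPf ->. Qed.

HB.instance Definition _ := GRing.ComNzRing_hasMulInverse.Build (fps R)
  fps_mulVf fps_unitPl fps_inv_out.

End FpsUnitRing.

Definition fpsX (R : comNzRingType) : fps R := FPS (fun n => (n == 1%N)%:R).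

Definition tri (m : nat) : nat := 'C(m.+1, 2).

(* The triangular binomial coefficient, for k <= n; nat subtraction is exact
   in that range. *)
Definition tribinom (n k : nat) : rat :=
  \prod_(0 <= j < k) ((tri (n - j))%:R / (tri (k - j))%:R).

(* Main.v *)
(** Up to the factor [1/k] the [j]-th coefficient of the numerator is
    [C(k, j) * C(k, j+1)], and [1 / (1 - x) ^ (2k+1)] has coefficients
    [C(n+2k, 2k)].  Comparing coefficients, the theorem becomes
    [\sum_j C(k, j) C(k, j+1) C(n+2k-j, 2k) = C(n+k, k-1) C(n+k+1, k+1)],
    a case of Nanjundiah's formula for a product of two binomial coefficients,
    which itself follows from three applications of Vandermonde's convolution. *)

Require Import Defs.
From mathcomp Require Import all_boot all_order all_algebra.
From mathcomp Require Import zify ring.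
Import GRing.Theory Num.Theory.
Local Open Scope ring_scope.

(** Both sides count nested subsets of sizes [j] and [k] of an [n]-set; they vanish when [k > n]. *)
Lemma mul_bin_trinom n k j : (j <= k)%N ->
  ('C(n, k) * 'C(k, j) = 'C(n, j) * 'C(n - j, k - j))%N.
Proof.
move=> jk; have [kn|nk] := leqP k n; last first.
  rewrite bin_small // mul0n; have [jn|nj] := leqP j n; last by rewrite bin_small.
  by rewrite [X in (_ * X)%N]bin_small ?muln0 // ltn_sub2r // (leq_ltn_trans jn).
have jn : (j <= n)%N by apply: leq_trans kn.
have fact_pos : (0 < j`! * (k - j)`! * (n - k)`!)%N by rewrite !muln_gt0 !fact_gt0.
apply/eqP; rewrite -(eqn_pmul2r fact_pos); apply/eqP.
transitivity n`!; first by rewrite -(bin_fact kn) -(bin_fact jk); ring.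
rewrite -(bin_fact jn) -(@bin_fact (n - j) (k - j)) ?leq_sub2r //.
by rewrite (_ : (n - j - (k - j) = n - k)%N); [ring | lia].
Qed.

(** Terms with [i < j] vanish; in the others [mul_bin_trinom] takes out ['C(a, j)] and leaves a
    Vandermonde sum. *)
Lemma Vandermonde_trinom a b n j : (j <= n)%N ->
  (\sum_(i < n.+1) 'C(a, i) * 'C(i, j) * 'C(b, n - i)
    = 'C(a, j) * 'C(a - j + b, n - j))%N.
Proof.
move=> /subnKC <-; move: (n - j)%N => p; rewrite -addnS big_split_ord /=.
rewrite big1 ?add0n => [|i _]; last by rewrite ['C(i, j)]bin_small ?muln0.
rewrite addKn -binomial.Vandermonde big_distrr /=; apply: eq_bigr => i _.
by rewrite mul_bin_trinom ?leq_addr // addKn subnDl mulnA.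
Qed.

(** Expand ['C(r + i, m + n)] over [j] and sum over [i] first. As [a + b = m + n], the result
    contains ['C(m + n - j, n - j)], which merges with ['C(r, m + n - j)] into
    ['C(r, m) * 'C(r - m, n - j)]; then sum over [j]. *)
Lemma Nanjundiah a b m n r : (a + b = m + n)%N ->
  (\sum_(i < n.+1) 'C(a, i) * 'C(b, n - i) * 'C(r + i, m + n)
    = 'C(r, m) * 'C(a + (r - m), n))%N.
Proof.
move=> abE.
have binD (i : 'I_n.+1) :
    'C(r + i, m + n) = (\sum_(j < n.+1) 'C(i, j) * 'C(r, m + n - j))%N.
  (* The convolution runs up to [m + n], but its terms with [j > n] vanish because [i <= n]. *)
  rewrite addnC -binomial.Vandermonde -addnS addnC big_split_ord /=
    [X in (_ + X)%N]big1 ?addn0 //.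
  by move=> j _; rewrite bin_small //; have := ltn_ord i; lia.
under eq_bigr do rewrite binD big_distrr.
rewrite exchange_big -binomial.Vandermonde big_distrr /=; apply: eq_bigr => j _.
have jn : (j <= n)%N by rewrite -ltnS.
transitivity ((\sum_(i < n.+1) 'C(a, i) * 'C(i, j) * 'C(b, n - i)) * 'C(r, m + n - j))%N.
  by rewrite big_distrl; apply: eq_bigr => i _ /=; ring.
rewrite Vandermonde_trinom //; have [ja|aj] := leqP j a; last first.
  by rewrite (bin_small aj) !mul0n muln0.
have -> : (a - j + b = m + n - j)%N by lia.
have jmn : (m <= m + n - j)%N by lia.
have E := mul_bin_trinom r _ _ jmn; rewrite -['C(_ - j, m)]bin_sub // in E.
rewrite (_ : (m + n - j - m = n - j)%N) in E; last by lia.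
by rewrite [RHS]mulnCA -E; ring.
Qed.

Lemma prod_tri n k : (k <= n)%N ->
  (2 ^ k * \prod_(0 <= j < k) tri (n - j) = n ^_ k * n.+1 ^_ k)%N.
Proof.
elim: k => [|k IHk] kn; first by rewrite big_geq.
have tri2 : (2 * tri (n - k) = (n.+1 - k) * (n - k))%N.
  by rewrite /tri -mul_bin_diag bin1 subSn // ltnW.
rewrite big_nat_recr //= expnSr !ffactnSr mulnACA IHk ?tri2 1?ltnW //.
by rewrite [in RHS]mulnACA [((n - k) * _)%N]mulnC.
Qed.

(** The Narayana form: with a factor [2 ^ k] on both products, [prod_tri] turns them into falling
    factorials. *)
Lemma tribinomE n k : (k <= n)%N ->
  tribinom n k = ('C(n, k) * 'C(n.+1, k))%:R / k.+1%:R.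
Proof.
move=> kn; rewrite /tribinom prodf_div -!natr_prod.
have pow2_neq0 : (2 ^ k)%N%:R != 0 :> rat by rewrite pnatr_eq0 expn_eq0.
rewrite -(mulKf pow2_neq0 (\prod_(0 <= i < k) tri (n - i))%:R).
rewrite -(mulKf pow2_neq0 (\prod_(0 <= i < k) tri (k - i))%:R).
rewrite -!natrM !prod_tri // ffactnn.
have -> : (k.+1 ^_ k = k.+1 * k`!)%N.
  by rewrite -bin_ffact binSn.
rewrite -!bin_ffact !natrM.
have kfact_neq0 : k`!%:R != 0 :> rat by rewrite pnatr_eq0 -lt0n fact_gt0.
have kS_neq0 : k.+1%:R != 0 :> rat by rewrite pnatr_eq0.
move: pow2_neq0 kfact_neq0 kS_neq0.
move: (2 ^ k)%N%:R k`!%:R k.+1%:R => p f c p0 f0 c0.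
by field; rewrite p0 f0 c0.
Qed.

Lemma coef_fpsX_mul (R : comNzRingType) (f : fps R) n :
  fps_coef (fpsX R * f) n = if n is m.+1 then fps_coef f m else 0.
Proof.
case: n => [|n] /=; first by rewrite big_ord1 mul0r.
rewrite big_ord_recl mul0r add0r big_ord_recl mul1r subn1.
by rewrite big1 ?addr0 // => i _; rewrite mul0r.
Qed.

Lemma coef_fpsXn_mul (R : comNzRingType) j (f : fps R) n :
  fps_coef (fpsX R ^+ j * f) n = if (j <= n)%N then fps_coef f (n - j) else 0.
Proof.
elim: j n => [|j IHj] n; first by rewrite mul1r subn0.
by rewrite exprS -mulrA coef_fpsX_mul; case: n => [|n] //; rewrite IHj.
Qed.

(** Multiplying by [1 - fpsX R] takes differences of consecutive coefficients, so Pascal's rule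
    lowers [m] by one. *)
Lemma expr_1subX_mul (R : comNzRingType) m :
  (1 - fpsX R) ^+ m.+1 * FPS (fun n => 'C(n + m, m)%:R) = 1.
Proof.
have coefB f g n : fps_coef (f - g : fps R) n = fps_coef f n - fps_coef g n by [].
elim: m => [|m IHm].
  rewrite expr1 mulrBl mul1r; apply: fpsP => n; rewrite coefB coef_fpsX_mul.
  by case: n => [|n] /=; rewrite ?subr0 ?bin0 ?subrr.
rewrite -[RHS]IHm [in LHS]exprSr -mulrA; congr (_ * _).
rewrite mulrBl mul1r; apply: fpsP => n; rewrite coefB coef_fpsX_mul.
case: n => [|n] /=; first by rewrite !add0n !binn subr0.
by rewrite addSn binS natrD addnS -addSn addrC addKr.
Qed.

Lemma fps_coef_sum (R : comNzRingType) I (r : seq I) P (F : I -> fps R) n :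
  fps_coef (\sum_(i <- r | P i) F i) n = \sum_(i <- r | P i) fps_coef (F i) n.
Proof. by apply: (big_morph (fun f : fps R => fps_coef f n)). Qed.

Lemma mul_tribinom_pred k j : (j < k)%N ->
  k%:R * tribinom k.-1 j = ('C(k, j) * 'C(k, j.+1))%:R.
Proof.
case: k => // k jk; rewrite tribinomE // mulrA -natrM mulnA (mul_bin_diag k.+1).
by rewrite -mulnA natrM mulrAC divff ?pnatr_eq0 // mul1r mulnC.
Qed.

(** Lowering the lower index of one binomial and raising that of the other both involve the factor
    [n + 1], which cancels. *)
Lemma mul_tribinom_add n k : (0 < k)%N ->
  k%:R * tribinom (n + k) k = ('C(n + k, k.-1) * 'C((n + k).+1, k.+1))%:R.
Proof.
case: k => // k _; rewrite tribinomE ?leq_addl //.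
have e1 := mul_bin_left (n + k.+1) k; have e2 := mul_bin_left (n + k.+1).+1 k.+1.
rewrite (_ : (n + k.+1 - k = n.+1)%N) in e1; last by lia.
rewrite (_ : ((n + k.+1).+1 - k.+1 = n.+1)%N) in e2; last by lia.
have k2_neq0 : k.+2%:R != 0 :> rat by rewrite pnatr_eq0.
rewrite mulrA -natrM; apply: (canLR (mulfK k2_neq0)); rewrite -natrM; congr (_%:R).
by rewrite mulnA e1 -mulnA -[RHS]mulnA [('C(_, _) * k.+2)%N]mulnC e2; ring.
Qed.

Lemma sum_tribinom n k : (0 < k)%N ->
  \sum_(j < k) tribinom k.-1 j *
      (if (j <= n)%N then 'C(n - j + 2 * k, 2 * k)%:R else 0)
    = tribinom (n + k) k.
Proof.
move=> k_gt0; have k_neq0 : k%:R != 0 :> rat by rewrite pnatr_eq0 -lt0n.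
apply: (mulfI k_neq0); rewrite mul_tribinom_add // big_distrr /=.
(* [Nanjundiah] is used with [a = b = k], lower indices [k + 1] and [k - 1], and [r = n + k + 1];
   its index is [k - 1 - j]. *)
have [abE kE] : (k + k = k.+1 + k.-1 /\ k + ((n + k).+1 - k.+1) = n + k)%N by lia.
rewrite [in RHS]mulnC -[X in 'C(X, k.-1)]kE -(Nanjundiah _ _ _ _ _ abE) natr_sum.
rewrite prednK // [RHS](reindex_inj rev_ord_inj); apply: eq_bigr => j _ /=.
have jk := ltn_ord j.
rewrite mulrA mul_tribinom_pred //.
(* For [j > n] the upper index [n + 2k - j] is below [2k]. *)
have -> : 'C((n + k).+1 + (k - j.+1), k.+1 + k.-1)
    = if (j <= n)%N then 'C(n - j + 2 * k, 2 * k) else 0%N.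
  case: leqP => jn; last by rewrite bin_small //; lia.
  by congr 'C(_, _); lia.
rewrite -(bin_sub jk) (_ : (k.-1 - (k - j.+1) = j)%N); last by lia.
by rewrite [('C(k, j) * _)%N]mulnC; case: ifP => _; rewrite ?natrM ?muln0 ?mulr0.
Qed.

Theorem theorem5 (k : nat) (hk : (0 < k)%N) :
  (\sum_(0 <= j < k) tribinom k.-1 j *: fpsX rat ^+ j)
    / (1 - fpsX rat) ^+ (2 * k + 1)
  = FPS (fun n => tribinom (n + k) k).
Proof.
have inv1X := expr_1subX_mul rat (2 * k); rewrite -addn1 in inv1X.
(* Invertibility makes the quotient genuine, so [divrK] can trade the division for a product with
   the explicit inverse. *)
have U : (1 - fpsX rat) ^+ (2 * k + 1) \is a GRing.unit.
  by apply/unitrPr; eexists; exact: inv1X.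
rewrite -[LHS]mulr1 -[X in _ * X = _]inv1X mulrA divrK //; apply: fpsP => n.
rewrite mulr_suml fps_coef_sum big_mkord [RHS]/= -sum_tribinom //.
apply: eq_bigr => j _; rewrite -scalerAl.
by rewrite -[LHS]/(_ * fps_coef (_ * _) _) coef_fpsXn_mul.
Qed.
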